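(* Let $\mathbf{x}\in\mathbb{R}^{N}$ be such that $|\mathrm{supp}(\mathbf{x})|\le K$, and let its measurement be $\mathbf{y}=\mathbf{\Phi}\mathbf{x}+\mathbf{e}\in\mathbb{R}^m$, where $\mathbf{e}\in\mathbb{R}^m$ denotes the noise vector. Suppose that the sampling matrix $\mathbf{\Phi}\in\mathbb{R}^{m\times N}$ satisfies the RIP with parameter $\delta_{3K}<0.083$. Then the output $\hat{\mathbf{x}}$ of the subspace pursuit (SP) algorithm with input $(K,\mathbf{\Phi},\mathbf{y})$ satisfies $$\|\mathbf{x}-\hat{\mathbf{x}}\|_2\le c_K'\,\|\mathbf{e}\|_2,\qquad\text{where}\quad c_K'=\frac{1+\delta_{3K}+\delta_{3K}^2}{\delta_{3K}(1-\delta_{3K})}.$$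
   Context: Notation: for an index set $I\subset\{1,\dots,N\}$, $\mathbf{\Phi}_I$ is the submatrix of columns of $\mathbf{\Phi}$ indexed by $I$ and $\mathbf{x}_I$ is the vector of entries of $\mathbf{x}$ indexed by $I$. $\mathrm{supp}(\mathbf{x})$ is the set of indices of nonzero entries. $^*$ denotes transposition. When $\mathbf{\Phi}_I^*\mathbf{\Phi}_I$ is invertible, $\mathbf{\Phi}_I^{\dagger}:=(\mathbf{\Phi}_I^*\mathbf{\Phi}_I)^{-1}\mathbf{\Phi}_I^*$, $\mathrm{proj}(\mathbf{y},\mathbf{\Phi}_I):=\mathbf{\Phi}_I\mathbf{\Phi}_I^{\dagger}\mathbf{y}$ and $\mathrm{resid}(\mathbf{y},\mathbf{\Phi}_I):=\mathbf{y}-\mathrm{proj}(\mathbf{y},\mathbf{\Phi}_I)$. RIP: for $K\le m$ and $0\le\delta\le1$, $\mathbf{\Phi}$ satisfies the RIP with parameters $(K,\delta)$ if $(1-\delta)\|\mathbf{q}\|_2^2\le\|\mathbf{\Phi}_I\mathbf{q}\|_2^2\le(1+\delta)\|\mathbf{q}\|_2^2$ for all $I\subset\{1,\dots,N\}$ with $|I|\le K$ and all $\mathbf{q}\in\mathbb{R}^{|I|}$. The RIP constant $\delta_K$ is the infimum of all such $\delta$. SP algorithm with input $(K,\mathbf{\Phi},\mathbf{y})$. Initialization: $T^0$ is the set of $K$ indices of the largest-magnitude entries of $\mathbf{\Phi}^*\mathbf{y}$, and $\mathbf{y}_r^0=\mathrm{resid}(\mathbf{y},\mathbf{\Phi}_{T^0})$.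 Iteration $\ell=1,2,\dots$: (1) $\tilde T^{\ell}=T^{\ell-1}\cup\{K$ indices of the largest-magnitude entries of $\mathbf{\Phi}^*\mathbf{y}_r^{\ell-1}\}$; (2) $\mathbf{x}_p=\mathbf{\Phi}_{\tilde T^{\ell}}^{\dagger}\mathbf{y}$ (a vector indexed by $\tilde T^{\ell}$); (3) $T^{\ell}$ is the set of the $K$ indices in $\tilde T^{\ell}$ of the largest-magnitude entries of $\mathbf{x}_p$; (4) $\mathbf{y}_r^{\ell}=\mathrm{resid}(\mathbf{y},\mathbf{\Phi}_{T^{\ell}})$; (5) if $\|\mathbf{y}_r^{\ell}\|_2>\|\mathbf{y}_r^{\ell-1}\|_2$, set $T^{\ell}=T^{\ell-1}$ and quit the iteration. Ties are broken arbitrarily. Output (upon quitting): $\hat{\mathbf{x}}$ with $\hat{\mathbf{x}}_{\{1,\dots,N\}-T^{\ell}}=\mathbf{0}$ and $\hat{\mathbf{x}}_{T^{\ell}}=\mathbf{\Phi}_{T^{\ell}}^{\dagger}\mathbf{y}$. *)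

(* Defs.v *)
From HB Require Import structures.
From mathcomp Require Import all_boot all_order all_algebra.
From mathcomp Require Import all_classical all_reals.

Set Implicit Arguments.
Unset Strict Implicit.
Unset Printing Implicit Defensive.

Import Order.TTheory GRing.Theory Num.Theory.

Local Open Scope ring_scope.

(* The norm that mathcomp-analysis puts on matrices is the sup norm, so the
   Euclidean norm is defined here. *)
Definition norm2 (R : realType) (n : nat) (v : 'cV[R]_n) : R :=
  Num.sqrt (\sum_(i < n) v i 0 ^+ 2).

Definition supp (R : realType) (N : nat) (x : 'cV[R]_N) : {set 'I_N} :=
  [set i | x i 0 != 0]%SET.

(* R^|I| is 'cV_#|I|: its coordinate k stands for the k-th element of I,
   namely [enum_val k]. *)
Definition subcols (R : realType) (m N : nat) (Phi : 'M[R]_(m, N))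
    (I : {set 'I_N}) : 'M[R]_(m, #|I|) :=
  colsub (fun k : 'I_#|I| => enum_val k) Phi.

Definition subvec (R : realType) (N : nat) (x : 'cV[R]_N)
    (I : {set 'I_N}) : 'cV[R]_#|I| :=
  rowsub (fun k : 'I_#|I| => enum_val k) x.

(* The vector of R^N that agrees with q on I and vanishes off I. *)
Definition extend0 (R : realType) (N : nat) (I : {set 'I_N})
    (q : 'cV[R]_#|I|) : 'cV[R]_N :=
  \sum_(k < #|I|) q k 0 *: delta_mx (enum_val k) 0.

(* Meaningful when A^T *m A is invertible; [invmx] is the identity on
   singular matrices. *)
Definition pinv (R : realType) (m n : nat) (A : 'M[R]_(m, n)) :
    'M[R]_(n, m) :=
  invmx (A^T *m A) *m A^T.

Definition proj (R : realType) (m n : nat) (y : 'cV[R]_m)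
    (A : 'M[R]_(m, n)) : 'cV[R]_m :=
  A *m (pinv A *m y).

Definition resid (R : realType) (m n : nat) (y : 'cV[R]_m)
    (A : 'M[R]_(m, n)) : 'cV[R]_m :=
  y - proj y A.

Definition rip (R : realType) (m N : nat) (Phi : 'M[R]_(m, N))
    (K : nat) (delta : R) : Prop :=
  [/\ (K <= m)%N,
      0 <= delta <= 1 &
      forall (I : {set 'I_N}) (q : 'cV[R]_#|I|), (#|I| <= K)%N ->
        (1 - delta) * norm2 q ^+ 2 <= norm2 (subcols Phi I *m q) ^+ 2
          <= (1 + delta) * norm2 q ^+ 2].

(* [inf] of the empty set is 0, so this is the RIP constant only when some
   delta satisfies [rip Phi K delta]. *)
Definition rip_const (R : realType) (m N : nat) (Phi : 'M[R]_(m, N))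
    (K : nat) : R :=
  inf [set delta | rip Phi K delta]%classic.

(* S consists of K indices of largest-magnitude entries of v among those in A.
   Several S qualify when there are ties. *)
Definition largest (R : realType) (N : nat) (K : nat) (A : {set 'I_N})
    (v : 'cV[R]_N) (S : {set 'I_N}) : Prop :=
  [/\ S \subset A,
      #|S| = K &
      forall i j : 'I_N, i \in S -> j \in A :\: S -> `|v j 0| <= `|v i 0|].

Definition sp_init (R : realType) (m N : nat) (K : nat)
    (Phi : 'M[R]_(m, N)) (y : 'cV[R]_m) (T : {set 'I_N}) : Prop :=
  largest K [set: 'I_N]%SET (Phi^T *m y) T.

(* Steps (1)-(3) of an iteration, from the support T to the support T', before
   the stopping test. *)
Definition sp_update (R : realType) (m N : nat) (K : nat)
    (Phi : 'M[R]_(m, N)) (y : 'cV[R]_m) (T T' : {set 'I_N}) : Prop :=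
  exists2 S : {set 'I_N},
    largest K [set: 'I_N]%SET (Phi^T *m resid y (subcols Phi T)) S &
    let Tt := T :|: S in
    let xp := pinv (subcols Phi Tt) *m y in
    largest K Tt (extend0 xp) T'.

(* xhat is the output of a run, under some choice at each tie, that quits at
   iteration l.+1. There the supports are T 0, ..., T l, and T l.+1 is the
   rejected one, which is reset to T l. A run that never quits has no
   output. *)
Definition sp_output (R : realType) (m N : nat) (K : nat)
    (Phi : 'M[R]_(m, N)) (y : 'cV[R]_m) (xhat : 'cV[R]_N) : Prop :=
  exists (l : nat) (T : nat -> {set 'I_N}),
    let yr (k : nat) := resid y (subcols Phi (T k)) in
    [/\ sp_init K Phi y (T 0%N),
        forall k : nat, (k <= l)%N -> sp_update K Phi y (T k) (T k.+1),
        forall k : nat, (k < l)%N -> norm2 (yr k.+1) <= norm2 (yr k),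
        norm2 (yr l.+1) > norm2 (yr l) &
        (forall i : 'I_N, i \notin T l -> xhat i 0 = 0) /\
        subvec xhat (T l) = pinv (subcols Phi (T l)) *m y].

(* Main.v *)
Require Import Defs.
From HB Require Import structures.
From mathcomp Require Import all_boot all_order all_algebra.
From mathcomp Require Import all_classical all_reals.
From mathcomp Require Import ring lra.

Set Implicit Arguments.
Unset Strict Implicit.
Unset Printing Implicit Defensive.

Import Order.TTheory GRing.Theory Num.Theory.

Local Open Scope ring_scope.

(** When the run quits, the next iteration has failed to lower the residual, and
    this alone bounds the error.  Write S for the support of x, z = x - xhat,
    and let one more iteration enlarge the support T to Tt = T :|: U, compute
    the least-squares fit p on Tt, and prune it to T'.  Every set in sight has
    at most 3K elements, so Phi^T *m Phi is within delta of the identity on all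
    the vectors involved ([rip_gram]) and the noise is amplified by at most
    sqrt (1 + delta) ([rip_noise]); put tau = sqrt (1 + delta) * norm2 e.
    - [identification]: by orthogonality the residual correlates with no column
      of T, and up to an error delta * norm2 z + tau its correlations are the
      entries of z.  Taking the K largest correlations therefore leaves out at
      most 2 * (delta * norm2 z + tau) of x outside Tt.
    - [least_squares_error]: the fit on Tt amplifies the part of x outside Tt
      by at most 1 / (1 - delta), up to noise.
    - [pruning]: restricting p to its K largest entries leaves out at most
      sqrt 2 * norm2 (x - p) of x outside T'.
    Altogether the part of x outside T' is small compared with z, up to a
    multiple of norm2 e.  The new residual is at most its image plus the noise
    ([norm2_resid_le]), whereas the old residual is about norm2 z, up to the
    noise ([norm2_image_error_le]).  As the new residual is the larger one,
    z is at most a multiple of norm2 e.  For delta < 0.083 the multiple 11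
    suffices ([quit_error]), and the constant of the theorem exceeds 11 on that
    range: its denominator is small, so 1 + delta + delta ^+ 2 is larger than
    11 * delta * (1 - delta). *)

(** * Euclidean inner product *)

Definition dot (R : realType) (n : nat) (u v : 'cV[R]_n) : R :=
  (u^T *m v) 0 0.

Section Dot.
Variables (R : realType) (n : nat).
Implicit Types (u v w : 'cV[R]_n) (c : R).

Lemma dotE u v : dot u v = \sum_i u i 0 * v i 0.
Proof. by rewrite /dot mxE; apply: eq_bigr => i _; rewrite mxE. Qed.

Lemma dotC u v : dot u v = dot v u.
Proof. by rewrite !dotE; apply: eq_bigr => i _; rewrite mulrC. Qed.

Lemma dotDr u v w : dot u (v + w) = dot u v + dot u w.
Proof. by rewrite /dot mulmxDr mxE. Qed.

Lemma dotDl u v w : dot (u + v) w = dot u w + dot v w.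
Proof. by rewrite /dot linearD mulmxDl mxE. Qed.

Lemma dotNr u v : dot u (- v) = - dot u v.
Proof. by rewrite /dot mulmxN mxE. Qed.

Lemma dotNl u v : dot (- u) v = - dot u v.
Proof. by rewrite dotC dotNr dotC. Qed.

Lemma dotZr c u v : dot u (c *: v) = c * dot u v.
Proof. by rewrite /dot -scalemxAr mxE. Qed.

Lemma dotZl c u v : dot (c *: u) v = c * dot u v.
Proof. by rewrite dotC dotZr dotC. Qed.

Lemma dot0l v : dot 0 v = 0.
Proof. by rewrite /dot trmx0 mul0mx mxE. Qed.

Lemma norm2_ge0 u : 0 <= norm2 u.
Proof. exact: sqrtr_ge0. Qed.

Lemma sqr_norm2_sum u : norm2 u ^+ 2 = \sum_i u i 0 ^+ 2.
Proof. by rewrite sqr_sqrtr // sumr_ge0 // => i _; rewrite sqr_ge0. Qed.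

Lemma sqr_norm2 u : norm2 u ^+ 2 = dot u u.
Proof. by rewrite sqr_norm2_sum dotE; apply: eq_bigr => i _; rewrite expr2. Qed.

Lemma norm2_eq0 u : norm2 u = 0 -> u = 0.
Proof.
move=> u0; have: \sum_i u i 0 ^+ 2 = 0 by rewrite -sqr_norm2_sum u0 expr0n.
move/eqP; rewrite psumr_eq0 => [/allP h|i _]; last exact: sqr_ge0.
apply/colP => i; rewrite mxE; apply/eqP; rewrite -sqrf_eq0.
by apply: h; rewrite mem_index_enum.
Qed.

Lemma norm2N u : norm2 (- u) = norm2 u.
Proof. by rewrite /norm2; congr Num.sqrt; apply: eq_bigr => i _; rewrite mxE sqrrN. Qed.

Lemma norm2_le u v : norm2 u ^+ 2 <= norm2 v ^+ 2 -> norm2 u <= norm2 v.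
Proof. by rewrite ler_pXn2r // nnegrE norm2_ge0. Qed.

Lemma norm2_pythagoras u v : dot u v = 0 ->
  norm2 (u + v) ^+ 2 = norm2 u ^+ 2 + norm2 v ^+ 2.
Proof.
by move=> uv; rewrite !sqr_norm2 dotDl !dotDr (dotC v u) uv addr0 add0r.
Qed.

End Dot.

Lemma dot_mulmx (R : realType) (m n : nat) (A : 'M[R]_(m, n))
    (u : 'cV[R]_m) (v : 'cV[R]_n) :
  dot u (A *m v) = dot (A^T *m u) v.
Proof. by rewrite /dot trmx_mul trmxK mulmxA. Qed.

(** * Supports and restrictions *)

Section SuppRestr.
Variables (R : realType) (N : nat).
Implicit Types (u v : 'cV[R]_N) (A B I : {set 'I_N}).

Lemma notin_supp v I i : supp v \subset I -> i \notin I -> v i 0 = 0.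
Proof.
move=> /fintype.subsetP h iI; apply/eqP; apply: contraNT iI => vi.
by apply: h; rewrite inE.
Qed.

Lemma supp_subP v I : (forall i, i \notin I -> v i 0 = 0) -> supp v \subset I.
Proof.
move=> h; apply/fintype.subsetP => i; rewrite inE; apply: contraNT => iI.
by rewrite h.
Qed.

Lemma suppD u v I : supp u \subset I -> supp v \subset I ->
  supp (u + v) \subset I.
Proof.
move=> hu hv; apply: supp_subP => i iI.
by rewrite mxE (notin_supp hu) // (notin_supp hv) // addr0.
Qed.

Lemma suppZ c v I : supp v \subset I -> supp (c *: v) \subset I.
Proof. by move=> hv; apply: supp_subP => i iI; rewrite mxE (notin_supp hv) // mulr0. Qed.

Lemma suppB u v I : supp u \subset I -> supp v \subset I ->
  supp (u - v) \subset I.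
Proof. by move=> hu hv; rewrite -scaleN1r; apply/suppD/suppZ. Qed.

Definition restr A v : 'cV[R]_N := \col_i (if i \in A then v i 0 else 0).

Lemma supp_restr A v : supp (restr A v) \subset A.
Proof. by apply: supp_subP => i /negbTE iA; rewrite mxE iA. Qed.

Lemma restrD A u v : restr A (u + v) = restr A u + restr A v.
Proof. by apply/colP => i; rewrite !mxE; case: ifP => //; rewrite addr0. Qed.

Lemma eq_restr A u v : {in A, forall i, u i 0 = v i 0} ->
  restr A u = restr A v.
Proof. by move=> h; apply/colP => i; rewrite !mxE; case: ifP => // /h. Qed.

Lemma sqr_norm2_restr A v : norm2 (restr A v) ^+ 2 = \sum_(i in A) v i 0 ^+ 2.
Proof.
rewrite sqr_norm2_sum [RHS]big_mkcond; apply: eq_bigr => i _.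
by rewrite mxE; case: ifP => // _; rewrite expr0n.
Qed.

Lemma dot_restr A v : dot (restr A v) v = norm2 (restr A v) ^+ 2.
Proof.
rewrite sqr_norm2_sum dotE; apply: eq_bigr => i _.
by rewrite mxE; case: ifP => _; rewrite ?expr2 ?mul0r.
Qed.

Lemma restr_decomp A v : v = restr A v + restr (~: A) v.
Proof.
by apply/colP => i; rewrite !mxE inE; case: ifP => _ /=; rewrite ?addr0 ?add0r.
Qed.

Lemma norm2_restrU A B v : [disjoint A & B] ->
  norm2 (restr A v) ^+ 2 + norm2 (restr B v) ^+ 2 <= norm2 v ^+ 2.
Proof.
move=> dAB; rewrite !sqr_norm2_restr -bigU //= sqr_norm2_sum.
rewrite [leRHS](bigID (mem [predU A & B])) /=.
by rewrite lerDl sumr_ge0 // => i _; rewrite sqr_ge0.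
Qed.

Lemma norm2_restrS A B v : A \subset B ->
  norm2 (restr A v) <= norm2 (restr B v).
Proof.
move=> sAB; apply: norm2_le; rewrite !sqr_norm2_restr.
rewrite [leRHS](big_setID A) /= (finset.setIidPr sAB) lerDl sumr_ge0 // => i _.
exact: sqr_ge0.
Qed.

End SuppRestr.

(** * Cauchy-Schwarz for symmetric forms *)

(** Polarization: 4 <u, M v> is the difference of the quadratic form at u + v and
    at u - v, hence at most 2 c (|u|^2 + |v|^2); rescaling u and v to a common
    norm turns the sum of squares into a product.  The case M = 1 is the
    Cauchy-Schwarz inequality, and M = Phi^T *m Phi - 1 gives the restricted
    near-orthogonality of the columns of Phi. *)
Lemma sym_form_bound (R : realType) (N : nat) (I : {set 'I_N})
    (M : 'M[R]_N) (c : R) (u v : 'cV[R]_N) :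
  M^T = M ->
  (forall w, supp w \subset I -> `|dot w (M *m w)| <= c * norm2 w ^+ 2) ->
  supp u \subset I -> supp v \subset I ->
  dot u (M *m v) <= c * (norm2 u * norm2 v).
Proof.
move=> symM hM hu hv.
have sym a b : dot a (M *m b) = dot b (M *m a) by rewrite dot_mulmx symM dotC.
have half a b : supp a \subset I -> supp b \subset I ->
    2 * dot a (M *m b) <= c * (norm2 a ^+ 2 + norm2 b ^+ 2).
  move=> ha hb; have := hM _ (suppD ha hb); have := hM _ (suppB ha hb).
  rewrite !ler_norml !sqr_norm2 => /andP[h1 _] /andP[_ h2].
  move: h1 h2.
  rewrite !(mulmxDr, mulmxN, dotDl, dotDr, dotNl, dotNr) (sym b a) (dotC b a).
  lra.
have [u0|nu0] := eqVneq (norm2 u) 0.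
  by rewrite (norm2_eq0 u0) dot0l -{1}(norm2_eq0 u0) u0 mul0r mulr0.
have [v0|nv0] := eqVneq (norm2 v) 0.
  by rewrite sym (norm2_eq0 v0) dot0l -{1}(norm2_eq0 v0) v0 !mulr0.
have up : 0 < norm2 u by rewrite lt_neqAle eq_sym nu0 norm2_ge0.
have vp : 0 < norm2 v by rewrite lt_neqAle eq_sym nv0 norm2_ge0.
have := half (norm2 v *: u) (norm2 u *: v) (suppZ _ hu) (suppZ _ hv).
rewrite !sqr_norm2 -scalemxAr !(dotZl, dotZr) -!sqr_norm2 => h.
have uvp : 0 < 2 * (norm2 u * norm2 v) by rewrite !mulr_gt0.
rewrite -(ler_pM2l uvp); apply: le_trans (le_trans h _); rewrite le_eqVlt; apply/orP; left; apply/eqP; ring.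
Qed.

Lemma cauchy_schwarz (R : realType) (n : nat) (u v : 'cV[R]_n) :
  dot u v <= norm2 u * norm2 v.
Proof.
have := @sym_form_bound R n [set: 'I_n]%SET 1%:M 1 u v (trmx1 _ _).
rewrite mul1mx mul1r; apply; rewrite ?finset.subsetT // => w _.
by rewrite mul1mx mul1r -sqr_norm2 ger0_norm // sqr_ge0.
Qed.

Lemma norm2D (R : realType) (n : nat) (u v : 'cV[R]_n) :
  norm2 (u + v) <= norm2 u + norm2 v.
Proof.
have h := cauchy_schwarz u v.
rewrite -(@ler_pXn2r _ 2) ?nnegrE ?addr_ge0 ?norm2_ge0 //.
rewrite sqr_norm2 !(dotDl, dotDr) (dotC v u) -!sqr_norm2.
by lra.
Qed.

Lemma norm2B (R : realType) (n : nat) (u v : 'cV[R]_n) :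
  norm2 (u - v) <= norm2 u + norm2 v.
Proof. by rewrite -(norm2N v) norm2D. Qed.

(** * Restricted isometries and least squares *)

Lemma sum_enum_val (V : nmodType) (T : finType) (I : {set T}) (F : T -> V) :
  (forall i, i \notin I -> F i = 0) ->
  \sum_(k < #|I|) F (enum_val k) = \sum_i F i.
Proof.
move=> h; rewrite -(big_enum_val (A := mem I) F) big_mkcond; apply: eq_bigr => i _.
by case: ifP => // /negbT /h.
Qed.

Section RIP.
Variables (R : realType) (m N k : nat) (Phi : 'M[R]_(m, N)) (delta : R).
Implicit Types (u v : 'cV[R]_N) (A I : {set 'I_N}).

Lemma mulmx_subvec I v : supp v \subset I ->
  subcols Phi I *m subvec v I = Phi *m v.
Proof.
move=> hv; apply/colP => j; rewrite !mxE.
rewrite -(sum_enum_val (I := I)) => [|i iI]; last first.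
  by rewrite (notin_supp hv) // mulr0.
by apply: eq_bigr => i _; rewrite !mxE.
Qed.

Lemma norm2_subvec I v : supp v \subset I -> norm2 (subvec v I) = norm2 v.
Proof.
move=> hv; rewrite /norm2; congr Num.sqrt.
rewrite -(sum_enum_val (I := I)) => [|i iI]; last first.
  by rewrite (notin_supp hv) // expr0n.
by apply: eq_bigr => i _; rewrite !mxE.
Qed.

Lemma resid_eq I v (y : 'cV[R]_m) :
  supp v \subset I -> subvec v I = Defs.pinv (subcols Phi I) *m y ->
  resid y (subcols Phi I) = y - Phi *m v.
Proof. by move=> hv hp; rewrite /resid /Defs.proj -hp mulmx_subvec. Qed.

Lemma extend0_enum_val I (q : 'cV[R]_#|I|) (j : 'I_#|I|) :
  extend0 q (enum_val j) 0 = q j 0.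
Proof.
rewrite /extend0 summxE (bigD1 j) //= big1 => [|l lj].
  by rewrite !mxE !eqxx mulr1 addr0.
by rewrite !mxE (inj_eq enum_val_inj) eq_sym (negbTE lj) mulr0.
Qed.

Lemma subvec_extend0 I (q : 'cV[R]_#|I|) : subvec (extend0 q) I = q.
Proof. by apply/colP => j; rewrite mxE extend0_enum_val. Qed.

Lemma supp_extend0 I (q : 'cV[R]_#|I|) : supp (extend0 q) \subset I.
Proof.
apply: supp_subP => i iI; rewrite /extend0 summxE big1 // => l _.
rewrite !mxE; case: eqP => [il|]; last by rewrite mulr0.
by rewrite il enum_valP in iI.
Qed.

Hypothesis hrip : rip Phi k delta.

(** The isometry property transported from coordinates indexed by I to vectors
    supported on I, which can be added when their supports differ. *)
Lemma rip_supp I v : (#|I| <= k)%N -> supp v \subset I ->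
  (1 - delta) * norm2 v ^+ 2 <= norm2 (Phi *m v) ^+ 2
    <= (1 + delta) * norm2 v ^+ 2.
Proof.
move=> hI hv; case: hrip => _ _ /(_ I (subvec v I) hI).
by rewrite mulmx_subvec // norm2_subvec.
Qed.

(** Testing the restriction g against itself: |g|^2 is the value at (g, v) of the
    symmetric form of Phi^T *m Phi - 1, which the isometry property bounds by
    delta on vectors supported on I. *)
Lemma rip_gram I A v : (#|I| <= k)%N -> supp v \subset I -> A \subset I ->
  norm2 (restr A ((Phi^T *m Phi - 1%:M) *m v)) <= delta * norm2 v.
Proof.
move=> hI hv hA; set M := (X in X *m v); set g := restr A _.
have [g0|gp] := eqVneq (norm2 g) 0.
  by case: hrip => _ /andP[d0 _] _; rewrite g0 mulr_ge0 ?norm2_ge0.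
have {}gp : 0 < norm2 g by rewrite lt_neqAle eq_sym gp norm2_ge0.
have hg : supp g \subset I := fintype.subset_trans (supp_restr _ _) hA.
rewrite -(ler_pM2l gp) -expr2 -dot_restr -/g.
rewrite [leRHS]mulrCA; apply: (@sym_form_bound _ _ I) => //.
  by rewrite /M linearB /= trmx_mul trmxK trmx1.
move=> w hw; rewrite /M mulmxBl mul1mx dotDr dotNr -mulmxA dot_mulmx trmxK.
rewrite -!sqr_norm2 ler_norml.
by have /andP[] := rip_supp hI hw; lra.
Qed.

(** Duality: the square of the left norm is the inner product of e with the image
    under Phi of a vector supported on A. *)
Lemma rip_noise A (e : 'cV[R]_m) : (#|A| <= k)%N ->
  norm2 (restr A (Phi^T *m e)) <= Num.sqrt (1 + delta) * norm2 e.
Proof.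
move=> hA; set g := restr A _.
have d0 : 0 <= 1 + delta by case: hrip => _ /andP[? _] _; rewrite addr_ge0.
have [g0|gp] := eqVneq (norm2 g) 0.
  by rewrite g0 mulr_ge0 ?norm2_ge0 ?sqrtr_ge0.
have {}gp : 0 < norm2 g by rewrite lt_neqAle eq_sym gp norm2_ge0.
rewrite -(ler_pM2l gp) -expr2 -dot_restr -/g dot_mulmx trmxK.
apply: le_trans (cauchy_schwarz _ _) _.
rewrite mulrA ler_wpM2r ?norm2_ge0 //.
rewrite -(@ler_pXn2r _ 2) ?nnegrE ?mulr_ge0 ?norm2_ge0 ?sqrtr_ge0 //.
rewrite exprMn (sqr_sqrtr d0) mulrC.
by have /andP[] := rip_supp hA (supp_restr _ (Phi^T *m e)).
Qed.

Lemma gram_unit I : delta < 1 -> (#|I| <= k)%N ->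
  (subcols Phi I)^T *m subcols Phi I \in unitmx.
Proof.
move=> d1 hI; rewrite -row_free_unit; apply: inj_row_free => v hv.
apply: trmx_inj; rewrite trmx0; apply: norm2_eq0; apply/eqP.
have : norm2 (subcols Phi I *m v^T) ^+ 2 = 0.
  by rewrite sqr_norm2 /dot trmx_mul trmxK -mulmxA [X in v *m X]mulmxA mulmxA hv mul0mx mxE.
case: hrip => _ _ /(_ I v^T hI) /andP[h _] h0; move: h.
rewrite h0 pmulr_rle0 ?subr_gt0 // => h.
by rewrite -sqrf_eq0 eq_le h sqr_ge0.
Qed.

(** The normal equations: the residual is orthogonal to the columns used in the
    fit. *)
Lemma pinv_orthogonal I v (y : 'cV[R]_m) : delta < 1 -> (#|I| <= k)%N ->
  supp v \subset I -> subvec v I = Defs.pinv (subcols Phi I) *m y ->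
  {in I, forall i, (Phi^T *m (y - Phi *m v)) i 0 = 0}.
Proof.
move=> d1 hI hv hp i iI.
have : (subcols Phi I)^T *m (y - Phi *m v) = 0.
  rewrite -(mulmx_subvec hv) hp /Defs.pinv mulmxBr !mulmxA.
  by rewrite mulmxV ?gram_unit // mul1mx subrr.
move/colP/(_ (enum_rank_in iI i)); rewrite !mxE => h; rewrite -[RHS]h.
by apply: eq_bigr => j _; rewrite !mxE enum_rankK_in.
Qed.

(** The difference of any competitor and the least-squares fit is supported on I,
    so its image is orthogonal to the residual. *)
Lemma resid_min I u (y : 'cV[R]_m) : delta < 1 -> (#|I| <= k)%N ->
  supp u \subset I -> norm2 (resid y (subcols Phi I)) <= norm2 (y - Phi *m u).
Proof.
move=> d1 hI hu; set p := extend0 (Defs.pinv (subcols Phi I) *m y).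
have hp : supp p \subset I := supp_extend0 _.
have sp := subvec_extend0 (Defs.pinv (subcols Phi I) *m y).
rewrite (resid_eq hp sp); apply: norm2_le.
have -> : y - Phi *m u = (y - Phi *m p) + Phi *m (p - u).
  by rewrite mulmxBr addrA subrK.
have o : dot (y - Phi *m p) (Phi *m (p - u)) = 0.
  rewrite dot_mulmx dotE big1 // => i _.
  have [iI|iI] := boolP (i \in I).
    by rewrite (pinv_orthogonal d1 hI hp sp) // mul0r.
  by rewrite (notin_supp (suppB hp hu)) // mulr0.
by rewrite (norm2_pythagoras o) lerDl sqr_ge0.
Qed.

End RIP.

(** * Selecting the largest entries *)

Lemma ler_sum_dominated (R : realDomainType) (T : finType) (X Y : {set T})
    (f : T -> R) :
  (#|X| <= #|Y|)%N -> (forall i, 0 <= f i) ->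
  (forall i j, i \in Y -> j \in X -> f j <= f i) ->
  \sum_(j in X) f j <= \sum_(i in Y) f i.
Proof.
move=> cXY f0 fXY.
have [->|[j0 j0X]] := finset.set_0Vmem X.
  by rewrite finset.big_set0 sumr_ge0.
case: (@arg_maxP _ _ _ j0 (mem X) f j0X) => j jX maxj.
apply: (@le_trans _ _ (\sum_(i in X) f j)); first exact: ler_sum.
apply: (@le_trans _ _ (\sum_(i in Y) f j)).
  by rewrite !sumr_const ler_wpMn2l.
by apply: ler_sum => i iY; apply: fXY.
Qed.

(** As S has at least as many elements as B, it gains at least as many entries
    outside B as it misses inside B, and each gained entry dominates each missed
    one.  Outside A the entries of v vanish, so B need not lie in A. *)
Lemma largest_norm2 (R : realType) (N K : nat) (A S B : {set 'I_N})
    (v : 'cV[R]_N) :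
  largest K A v S -> supp v \subset A -> (#|B| <= K)%N ->
  norm2 (restr (B :\: S) v) <= norm2 (restr (S :\: B) v).
Proof.
move=> [sSA cS hS] hv cB; apply: norm2_le; rewrite !sqr_norm2_restr.
apply: ler_sum_dominated => [|i|i j]; last 2 first.
- exact: sqr_ge0.
- rewrite !inE => /andP[_ iS] /andP[jS _].
  rewrite -[leLHS]real_normK ?num_real // -[leRHS]real_normK ?num_real //.
  rewrite ler_pXn2r ?nnegrE //.
  have [jA|jA] := boolP (j \in A); first by apply: hS; rewrite // inE jS.
  by rewrite (notin_supp hv jA) normr0.
rewrite -(leq_add2l #|B :&: S|) cardsID finset.setIC cardsID cS; exact: cB.
Qed.

(** * One iteration of the pursuit *)

Section PursuitStep.
Variables (R : realType) (m N K : nat) (Phi : 'M[R]_(m, N)) (delta : R).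
Hypotheses (hrip : rip Phi (3 * K) delta) (hdelta1 : delta < 1).
Variables (x : 'cV[R]_N) (e y : 'cV[R]_m).
Hypotheses (hx : (#|supp x| <= K)%N) (hy : y = Phi *m x + e).
Implicit Types (T U I A : {set 'I_N}) (v p : 'cV[R]_N).

(** Bound on the correlation of the noise with any 3K columns. *)
Let tau : R := Num.sqrt (1 + delta) * norm2 e.

Lemma residE v : y - Phi *m v = Phi *m (x - v) + e.
Proof. by rewrite hy mulmxBr addrAC. Qed.

(** The correlations are a perturbation of the error x - v itself; the second
    summand is what [norm2_perturbation] shows to be small on few indices. *)
Lemma correlationE v : Phi^T *m (y - Phi *m v) =
  (x - v) + ((Phi^T *m Phi - 1%:M) *m (x - v) + Phi^T *m e).
Proof.
rewrite residE mulmxDr mulmxA addrA; congr (_ + _).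
by rewrite mulmxBl mul1mx addrC subrK.
Qed.

Lemma norm2_perturbation I A v : (#|I| <= 3 * K)%N ->
  supp (x - v) \subset I -> A \subset I ->
  norm2 (restr A ((Phi^T *m Phi - 1%:M) *m (x - v) + Phi^T *m e))
    <= delta * norm2 (x - v) + tau.
Proof.
move=> hI hv hA; rewrite restrD /tau.
have := norm2D (restr A ((Phi^T *m Phi - 1%:M) *m (x - v)))
  (restr A (Phi^T *m e)).
have := rip_gram hrip hI hv hA.
have := rip_noise hrip e (leq_trans (subset_leq_card hA) hI).
by lra.
Qed.

(** Let z = x - v.  Missed indices (in S but not in U) have correlations of
    norm at most that of the gained ones (in U but not in S).  The latter can be
    taken outside T, where the correlations vanish, and outside S and T the
    vector z vanishes, so these correlations are pure perturbation.  On the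
    missed indices z is the correlation minus a perturbation: hence the
    factor 2. *)
Lemma identification T U v : (#|T| <= K)%N -> supp v \subset T ->
  subvec v T = Defs.pinv (subcols Phi T) *m y ->
  largest K [set: 'I_N]%SET (Phi^T *m resid y (subcols Phi T)) U ->
  norm2 (restr (~: (T :|: U)) x) <= 2 * (delta * norm2 (x - v) + tau).
Proof.
move=> hT hv hp; rewrite (resid_eq hv hp) => hU.
have cU : (#|U| <= K)%N by case: hU => _ ->.
set S := supp x; set I := S :|: T :|: U.
have hI : (#|I| <= 3 * K)%N.
  rewrite (leq_trans (leq_card_setU _ _)) // mulSn addnC leq_add //.
  by rewrite (leq_trans (leq_card_setU _ _)) // mul2n -addnn leq_add.
have hz : supp (x - v) \subset S :|: T.
  apply: suppB; first exact: finset.subsetUl.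
  exact: fintype.subset_trans hv (finset.subsetUr _ _).
have hzI : supp (x - v) \subset I.
  exact: fintype.subset_trans hz (finset.subsetUl _ _).
set P := (Phi^T *m Phi - 1%:M) *m (x - v) + Phi^T *m e.
set h := Phi^T *m (y - Phi *m v) in hU.
have hE : h = (x - v) + P := correlationE v.
have hT0 : {in T, forall i, h i 0 = 0}.
  by apply: (pinv_orthogonal hrip) => //; rewrite (leq_trans hT) // leq_pmull.
set A := S :\: U; set C := U :\: (S :|: T).
have miss : norm2 (restr (~: (T :|: U)) x) <= norm2 (restr A (x - v)).
  have -> : restr (~: (T :|: U)) x = restr (S :\: (T :|: U)) (x - v).
    apply/colP => i; rewrite !mxE !inE.
    case iT: (i \in T) => //=; case iU: (i \in U) => //=.
    rewrite (notin_supp hv) ?iT // subr0.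
    by case: eqP => [->|].
  by apply: norm2_restrS; rewrite finset.setDS // finset.subsetUr.
have top : norm2 (restr A h) <= norm2 (restr C h).
  apply: le_trans (largest_norm2 hU (finset.subsetT _) hx) _.
  rewrite le_eqVlt; apply/orP; left; apply/eqP; congr norm2.
  apply/colP => i; rewrite [LHS]mxE [RHS]mxE !inE.
  by case iT: (i \in T); rewrite ?orbT ?orbF // (hT0 _ iT) !if_same.
have CP : restr C h = restr C P.
  apply: eq_restr => i; rewrite inE => /andP[iST _].
  by rewrite hE mxE (notin_supp hz) // add0r.
have AP : restr A (x - v) = restr A h - restr A P.
  by rewrite hE (restrD A (x - v)) addrK.
have bA : norm2 (restr A P) <= delta * norm2 (x - v) + tau.
  apply: norm2_perturbation hI hzI _.
  by rewrite (fintype.subset_trans (finset.subsetDl _ _)) // /I -finset.setUA finset.subsetUl.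
have bC : norm2 (restr C P) <= delta * norm2 (x - v) + tau.
  apply: norm2_perturbation hI hzI _.
  by rewrite (fintype.subset_trans (finset.subsetDl _ _)) // finset.subsetUr.
have := norm2B (restr A h) (restr A P); rewrite -AP; move: top; rewrite CP.
by lra.
Qed.

(** On I the correlations of the residual vanish, so there x - v is the opposite
    of a perturbation, of norm at most delta * norm2 (x - v) + tau; off I it
    is x. *)
Lemma least_squares_error I v : (#|I| <= 2 * K)%N -> supp v \subset I ->
  subvec v I = Defs.pinv (subcols Phi I) *m y ->
  (1 - delta) * norm2 (x - v) <= norm2 (restr (~: I) x) + tau.
Proof.
move=> hI hv hp; set J := supp x :|: I.
have hI3 : (#|I| <= 3 * K)%N by rewrite (leq_trans hI) // leq_mul2r orbT.
have hJ : (#|J| <= 3 * K)%N.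
  by rewrite (leq_trans (leq_card_setU _ _)) // mulSn leq_add.
have hz : supp (x - v) \subset J.
  apply: suppB; first exact: finset.subsetUl.
  exact: fintype.subset_trans hv (finset.subsetUr _ _).
set P := (Phi^T *m Phi - 1%:M) *m (x - v) + Phi^T *m e.
have zI : restr I (x - v) = - restr I P.
  apply/eqP; rewrite -subr_eq0 opprK -restrD -correlationE; apply/eqP/colP => i.
  rewrite !mxE; case: ifP => // iI.
  by have := pinv_orthogonal hrip hdelta1 hI3 hv hp iI; rewrite !mxE.
have zIc : restr (~: I) (x - v) = restr (~: I) x.
  apply: eq_restr => i; rewrite inE => iI.
  by rewrite !mxE (notin_supp hv) // subr0.
have bI : norm2 (restr I P) <= delta * norm2 (x - v) + tau.
  exact: norm2_perturbation hJ hz (finset.subsetUr _ _).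
have := norm2D (restr I (x - v)) (restr (~: I) (x - v)).
rewrite -restr_decomp zIc zI norm2N.
by lra.
Qed.

(** On the missed indices x is (x - p) + p, and p is dominated there by its
    entries at the selected indices outside the support of x, where it agrees
    with p - x.  So two disjoint parts of x - p account for everything, which
    yields the factor 2 on squares instead of 4. *)
Lemma pruning A T p : supp p \subset A -> largest K A p T ->
  norm2 (restr (~: T) x) ^+ 2 <= 2 * norm2 (x - p) ^+ 2.
Proof.
move=> hp hT; set S := supp x.
have miss : restr (~: T) x = restr (S :\: T) (x - p) + restr (S :\: T) p.
  rewrite -restrD subrK; apply/colP => i; rewrite !mxE !inE.
  by case: (i \in T) => //=; case: eqP => [->|].
have extra : restr (T :\: S) p = - restr (T :\: S) (x - p).
  apply/colP => i; rewrite !mxE !inE; case: eqP => [->|] /=; last by rewrite oppr0.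
  by case: ifP => _; rewrite ?oppr0 // sub0r opprK.
have swap := largest_norm2 hT hp hx.
have disj : [disjoint S :\: T & T :\: S].
  rewrite -setI_eq0; apply/eqP/finset.setP => i; rewrite !inE.
  by case: (i \in T) => /=; rewrite ?andbF.
have := norm2_restrU (x - p) disj.
have := norm2D (restr (S :\: T) (x - p)) (restr (S :\: T) p).
rewrite -miss; move: swap; rewrite extra norm2N.
have := norm2_ge0 (restr (~: T) x).
set a := norm2 _; set b := norm2 (restr (T :\: S) _).
set c := norm2 (restr _ p); set d := norm2 (restr (S :\: T) _).
move=> a0 cb ac ab.
have h : a <= d + b by lra.
have : a ^+ 2 <= (d + b) ^+ 2 by rewrite ler_pXn2r ?nnegrE // (le_trans a0).
by have := sqr_ge0 (d - b); nra.
Qed.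

(** The restriction of x to I competes with the least-squares fit. *)
Lemma norm2_resid_le I : (#|I| <= 3 * K)%N ->
  norm2 (resid y (subcols Phi I)) <=
    norm2 (Phi *m restr (~: I) x) + norm2 e.
Proof.
move=> hI; apply: le_trans (resid_min hrip _ hdelta1 hI (supp_restr I x)) _.
rewrite residE {1}(restr_decomp I x) addrAC subrr add0r.
exact: norm2D.
Qed.

Lemma norm2_image_error_le I v : supp v \subset I ->
  subvec v I = Defs.pinv (subcols Phi I) *m y ->
  norm2 (Phi *m (x - v)) <= norm2 (resid y (subcols Phi I)) + norm2 e.
Proof.
move=> hv hp; rewrite (resid_eq hv hp) residE.
by have := norm2B (Phi *m (x - v) + e) e; rewrite addrK.
Qed.

(** Write D = norm2 e, z = norm2 (x - v), w = norm2 (x - p).  The rejected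
    residual gives 0.95 z <= 1.5 w + 2 D, and [identification] with
    [least_squares_error] gives 0.917 w <= 0.166 z + 3.15 D; eliminating w yields z <= 11 D. *)
Lemma quit_error T T' v : delta < 83 / 1000 -> #|T| = K -> supp v \subset T ->
  subvec v T = Defs.pinv (subcols Phi T) *m y ->
  sp_update K Phi y T T' ->
  norm2 (resid y (subcols Phi T)) < norm2 (resid y (subcols Phi T')) ->
  norm2 (x - v) <= 11 * norm2 e.
Proof.
move=> d83 cT hv hp [U hU] /= hT' hlt.
set p := extend0 _ in hT'.
set Tt := T :|: U in p hT'.
have cU : #|U| = K by case: hU.
have cT' : #|T'| = K by case: hT'.
have le3 n : (n <= K)%N -> (n <= 3 * K)%N.
  by move=> h; rewrite (leq_trans h) // leq_pmull.
have cTt : (#|Tt| <= 2 * K)%N.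
  by rewrite (leq_trans (leq_card_setU _ _)) // cT cU addnn mul2n.
have d0 : 0 <= delta by case: hrip => _ /andP[].
have spT : supp p \subset Tt := supp_extend0 _.
have ident := identification (eq_leq cT) hv hp hU.
have ls := least_squares_error cTt spT (subvec_extend0 _).
have prune := pruning spT hT'.
have ub := norm2_resid_le (le3 _ (eq_leq cT')).
have lb := norm2_image_error_le hv hp.
have ripx : norm2 (Phi *m restr (~: T') x) ^+ 2
    <= (1 + delta) * norm2 (restr (~: T') x) ^+ 2.
  have sx : supp (restr (~: T') x) \subset supp x.
    by apply: supp_subP => i; rewrite inE negbK => /eqP xi; rewrite mxE xi if_same.
  by have /andP[] := rip_supp hrip (le3 _ hx) sx.
have ripz : (1 - delta) * norm2 (x - v) ^+ 2 <= norm2 (Phi *m (x - v)) ^+ 2.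
  have hz : supp (x - v) \subset supp x :|: T.
    apply: suppB; first exact: finset.subsetUl.
    exact: fintype.subset_trans hv (finset.subsetUr _ _).
  have cz : (#|supp x :|: T| <= 3 * K)%N.
    rewrite (leq_trans (leq_card_setU _ _)) // cT !mulSn mul0n addn0.
    by rewrite leq_add // leq_addr.
  by have /andP[] := rip_supp hrip cz hz.
(* 1.05, 1.5 and 0.95 are rational bounds for the square roots of 1 + delta,
   2 * (1 + delta) and 1 - delta. *)
have tau_ub : tau <= 105 / 100 * norm2 e.
  rewrite ler_wpM2r ?norm2_ge0 // -(@ler_pXn2r _ 2) ?nnegrE ?sqrtr_ge0 //; last by lra.
  by rewrite sqr_sqrtr; nra.
have pruned : norm2 (Phi *m restr (~: T') x) <= 3 / 2 * norm2 (x - p).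
  rewrite -(@ler_pXn2r _ 2) ?nnegrE ?mulr_ge0 ?invr_ge0 ?norm2_ge0 //.
  by have := sqr_ge0 (norm2 (x - p)); rewrite exprMn; nra.
have seen : 95 / 100 * norm2 (x - v) <= norm2 (Phi *m (x - v)).
  rewrite -(@ler_pXn2r _ 2) ?nnegrE ?mulr_ge0 ?invr_ge0 ?norm2_ge0 //.
  by have := sqr_ge0 (norm2 (x - v)); rewrite exprMn; nra.
have e0 := norm2_ge0 e; have z0 := norm2_ge0 (x - v); have w0 := norm2_ge0 (x - p).
have dz : delta * norm2 (x - v) <= 83 / 1000 * norm2 (x - v).
  by rewrite ler_wpM2r // ltW.
have dw : delta * norm2 (x - p) <= 83 / 1000 * norm2 (x - p).
  by rewrite ler_wpM2r // ltW.
move: ident ls; rewrite -/Tt; lra.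
Qed.

End PursuitStep.

Theorem theorem9 (R : realType) (m N K : nat) (Phi : 'M[R]_(m, N))
    (x xhat : 'cV[R]_N) (e y : 'cV[R]_m) (delta : R)
    (hx : (#|supp x| <= K)%N)
    (hy : y = Phi *m x + e)
    (hdelta : delta = rip_const Phi (3 * K))
    (hrip : rip Phi (3 * K) delta)
    (hdelta_pos : 0 < delta)
    (hdelta_lt : delta < 83 / 1000)
    (hxhat : sp_output K Phi y xhat) :
  norm2 (x - xhat)
    <= (1 + delta + delta ^+ 2) / (delta * (1 - delta)) * norm2 e.
Proof.
case: hxhat => l [T] [hinit hupd _ hquit [xhat0 xhatT]].
have cT : #|T l| = K.
  case: l hupd {hquit xhat0 xhatT} => [|l] hupd; first by case: hinit.
  by have [U _ []] := hupd l (leqnSn l).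
have d1 : delta < 1 by lra.
have h11 : norm2 (x - xhat) <= 11 * norm2 e.
  have sup := supp_subP xhat0; have upd := hupd l (leqnn l).
  exact: (quit_error hrip d1 hx hy hdelta_lt cT sup xhatT upd hquit).
apply: le_trans h11 _; rewrite ler_wpM2r ?norm2_ge0 //.
(* 11 * delta * (1 - delta) <= 1 + delta + delta ^+ 2 because
   10 * delta <= 0.83. *)
by rewrite ler_pdivlMr; nra.
Qed.
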